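(* Let $L$ be a field of characteristic $0$ and let $A=L((T^{-1};\tilde\delta))$ be a deformed Laurent series ring with the standard degree map such that $$T\cdot a=aT+\sum_{i=0}^{-\infty}\delta_i(a)T^i,\qquad a\in L,$$ for maps $\delta_i:L\to L$ ($i\in\mathbb{Z}_{\le 0}$), with $\delta_i\ne 0$ for some $i\le 0$. Let $K=\bigcap_{i\le 0}\mathrm{Ker}(\delta_i)$. Then for all $i\le 0$ and $a,b\in L$, $$\delta_i(ab)=a\,\delta_i(b)+\delta_i(a)\,b+\sum_{k>0}\ \sum_{\substack{l,j_1,\dots,j_k\in\mathbb{Z}_{\le 0}\\ j_1+\cdots+j_k-k+l=i}}\binom{l}{k}\,\delta_l(a)\,\delta_{j_1}\cdots\delta_{j_k}(b).$$ Let $i_0=\max\{i\in\mathbb{Z}_{\le 0}:\delta_i\neq 0\}$. Then $\delta_{i_0}$ is a $K$-linear derivation of $L$, and each $\delta_i$, $i\le 0$, is a $K$-linear differential operator of $L$.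
   Context: For a field $L$, $L((T^{-1}))=\{\sum_{i\le k} a_iT^i : a_i\in L,\ k\in\mathbb{Z}\}$ is the left $L$-vector space of (inverse) formal Laurent series. The standard degree map is $\deg 0=-\infty$, $\deg(\sum_{i\le k}a_iT^i)=k$ if $a_k\neq 0$. The topology is induced by the metric $d(f,g)=e^{\deg(f-g)}$. A deformed Laurent series ring (with the standard degree map) $L((T^{-1};\tilde\delta))$ is $L((T^{-1}))$ with its usual addition, standard degree map and topology, together with a multiplication $\tilde\delta:(f,g)\mapsto f\cdot g$ such that: (i) the multiplication is associative, distributive over addition, and continuous; (ii) $b\cdot \sum_{i\le k}a_iT^i=\sum_{i\le k}(ba_i)T^i$ for $b\in L$; (iii) $T^i\cdot T^j=T^{i+j}$ for $i,j\in\mathbb{Z}$ (with $T^0=1$); (iv) $\deg(f\cdot g)=\deg f+\deg g$ for all $f,g$. $K$ is the center of $A$ and is a subfield of $L$. For an integer $a$ and $k\ge 0$, $\binom{a}{k}=a(a-1)\cdots(a-k+1)/k!$. ''Differential operator'' is meant in the usual sense of a (possibly high order) $K$-linear differential operator on the commutative $K$-algebra $L$. *)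

(* Defs.v *)
From HB Require Import structures.
From mathcomp Require Import all_boot all_order all_algebra.
From mathcomp Require Import all_classical all_reals all_analysis.
From mathcomp Require Import Rstruct Rstruct_topology.

Set Implicit Arguments.
Unset Strict Implicit.
Unset Printing Implicit Defensive.

Import Order.TTheory GRing.Theory Num.Theory.

Local Open Scope classical_set_scope.
Local Open Scope ring_scope.

(* The concrete real numbers, as the value type of the metric. *)
Notation RR := Rdefinitions.R.

(* A Laurent series in T^-1 is its family of coefficients, indexed by int:
   f i is the coefficient of T^i. *)
Definition bounded_above (L : fieldType) : {pred int -> L} :=
  fun f => `[< exists k : int, forall i, k < i -> f i = 0 >].

Record laurent (L : fieldType) :=
  Laurent { coefl :> int -> L; _ : coefl \in @bounded_above L }.

HB.instance Definition _ (L : fieldType) := [isSub for @coefl L].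
HB.instance Definition _ (L : fieldType) := [Choice of laurent L by <:].

Lemma bounded_above_zmod_closed (L : fieldType) :
  zmod_closed (@bounded_above L).
Proof.
split=> [|f g /asboolP[k hk] /asboolP[m hm]]; apply/asboolP; first by exists 0.
exists (Num.max k m) => i; rewrite gt_max => /andP[ki mi].
by rewrite /GRing.add /GRing.opp /= hk// hm// subr0.
Qed.

HB.instance Definition _ (L : fieldType) :=
  GRing.isZmodClosed.Build _ (@bounded_above L) (@bounded_above_zmod_closed L).
HB.instance Definition _ (L : fieldType) :=
  [SubChoice_isSubZmodule of laurent L by <:].

Lemma trunc_bounded (L : fieldType) (k : int) (a : int -> L) :
  (fun i => if i <= k then a i else 0) \in @bounded_above L.
Proof. by apply/asboolP; exists k => i ki; rewrite leNgt ki. Qed.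

(* \sum_(i <= k) a_i T^i *)
Definition lseries (L : fieldType) (k : int) (a : int -> L) : laurent L :=
  Laurent (trunc_bounded k a).

(* a T^i *)
Definition lmonom (L : fieldType) (a : L) (i : int) : laurent L :=
  lseries i (fun j => if j == i then a else 0).

Definition lconst (L : fieldType) (a : L) : laurent L := lmonom a 0.

Definition Tpow (L : fieldType) (i : int) : laurent L := lmonom 1 i.

Definition degl (L : fieldType) (f : laurent L) : \bar int :=
  if f == 0 then -oo%E
  else (xget 0 [set k : int | f k != 0 /\ forall i, k < i -> f i = 0])%:E.

(* exp (deg (f - g)), with exp (-oo) = 0; deg never takes the value +oo. *)
Definition ldist (L : fieldType) (f g : laurent L) : RR :=
  if degl (f - g) is k%:E then expR (k%:~R : RR) else 0.

Lemma laurentP (L : fieldType) (f g : laurent L) :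
  (forall i, f i = g i) -> f = g.
Proof. by move=> fg; apply/val_inj/funext. Qed.

Lemma coefl0 (L : fieldType) i : (0 : laurent L) i = 0.
Proof. by []. Qed.

Lemma coeflD (L : fieldType) (f g : laurent L) i : (f + g) i = f i + g i.
Proof. by []. Qed.

Lemma coeflN (L : fieldType) (f : laurent L) i : (- f) i = - f i.
Proof. by []. Qed.

Lemma degl0 (L : fieldType) : degl (0 : laurent L) = -oo%E.
Proof. by rewrite /degl eqxx. Qed.

Lemma deglP (L : fieldType) (f : laurent L) : f != 0 ->
  exists k : int,
    [/\ degl f = k%:E, f k != 0 & forall i, k < i -> f i = 0].
Proof.
move=> f0; rewrite /degl (negbTE f0).
set S := [set k : int | _].
suff [k Sk] : exists k, S k.
  by have [h1 h2] := xgetI 0 Sk; exists (xget 0 S).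
have /asboolP[m hm] := valP f.
have [i fi] : exists i, f i != 0.
  apply: contrapT => h; move/eqP: f0; apply; apply: laurentP => i.
  by apply/eqP; apply: contrapT => /negP fi; apply: h; exists i.
have im : i <= m by rewrite leNgt; apply/negP => /hm /eqP; rewrite (negbTE fi).
have exn : exists n : nat, f (m - n%:Z) != 0.
  by exists `|m - i|%N; rewrite gez0_abs ?subr_ge0// opprB addrCA subrr addr0.
case: (ex_minnP exn) => n fn nmin; exists (m - n%:Z); split=> // j hj.
have [mj|jm] := ltP m j; first exact: hm.
apply/eqP; apply: contraTT hj => fj; rewrite -leNgt lerBrDr -lerBrDl.
have mj : m - j = `|m - j|%N%:Z by rewrite gez0_abs ?subr_ge0.
by rewrite mj lez_nat nmin// -mj opprB addrCA subrr addr0.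
Qed.

Lemma ldist_lt (L : fieldType) (f g : laurent L) (k : int) :
  (ldist f g < expR (k%:~R : RR)) = `[< forall i, k <= i -> f i = g i >].
Proof.
rewrite /ldist; apply/idP/asboolP.
  have [/eqP|/deglP[d [-> _ dmax]]] := eqVneq (f - g) 0.
    by rewrite subr_eq0 => /eqP->.
  rewrite ltr_expR ltr_int => dk i ki.
  by apply/eqP; rewrite -subr_eq0 -coeflN -coeflD dmax// (lt_le_trans dk).
move=> fg; have [->|/deglP[d [-> dn0 _]]] := eqVneq (f - g) 0.
  by rewrite degl0 expR_gt0.
rewrite ltr_expR ltr_int ltNge; apply: contra dn0 => kd.
by rewrite coeflD coeflN fg// subrr.
Qed.

Lemma ldistxx (L : fieldType) (f : laurent L) : ldist f f = 0.
Proof. by rewrite /ldist subrr degl0. Qed.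

Lemma ldist_ge0 (L : fieldType) (f g : laurent L) : 0 <= ldist f g.
Proof. by rewrite /ldist; case: (degl _) => // k; exact: expR_ge0. Qed.

Lemma ldist_positivity (L : fieldType) (f g : laurent L) :
  ldist f g = 0 -> f = g.
Proof.
move=> fg0; apply: laurentP => i.
have : ldist f g < expR (i%:~R : RR) by rewrite fg0 expR_gt0.
by rewrite ldist_lt => /asboolP; exact.
Qed.

Lemma ldist_sym (L : fieldType) (f g : laurent L) : ldist f g = ldist g f.
Proof.
rewrite /ldist; congr (if _ is k%:E then _ else _).
rewrite /degl -[g - f]opprB oppr_eq0; congr (if _ then _ else (xget _ _)%:E).
apply/seteqP; split=> k [k0 kmax]; split.
- by rewrite coeflN oppr_eq0.
- by move=> i /kmax; rewrite coeflN => ->; rewrite oppr0.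
- by rewrite coeflN oppr_eq0 in k0.
- by move=> i /kmax /eqP; rewrite coeflN oppr_eq0 => /eqP.
Qed.

Lemma ldist_triangle (L : fieldType) (g f h : laurent L) :
  ldist f h <= ldist f g + ldist g h.
Proof.
have [fh|/deglP[d [dE dn0 _]]] := eqVneq (f - h) 0.
  by rewrite {1}/ldist fh degl0 addr_ge0// ldist_ge0.
have dfh : ldist f h = expR (d%:~R : RR) by rewrite /ldist dE.
have [fg|fg] := leP (expR (d%:~R : RR)) (ldist f g).
  by rewrite dfh (le_trans fg)// lerDl ldist_ge0.
have [gh|gh] := leP (expR (d%:~R : RR)) (ldist g h).
  by rewrite dfh (le_trans gh)// lerDr ldist_ge0.
move: fg gh; rewrite !ldist_lt => /asboolP fg /asboolP gh.
by move: dn0; rewrite coeflD coeflN fg// gh// subrr eqxx.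
Qed.

HB.instance Definition _ (L : fieldType) :=
  @isMetric.Build RR (laurent L) (@ldist L) (@ldistxx L)
    (@ldist_positivity L) (@ldist_sym L) (@ldist_triangle L).

(* The embedding of L is lconst, so that T^0 = 1 holds by definition of Tpow. *)
Record deformed_mul (L : fieldType)
    (mul : laurent L -> laurent L -> laurent L) : Prop := DeformedMul {
  dmulA : associative mul;
  dmulDl : left_distributive mul +%R;
  dmulDr : right_distributive mul +%R;
  dmul_continuous :
    continuous (fun fg : laurent L * laurent L => mul fg.1 fg.2);
  dmul_scale : forall (b : L) (k : int) (a : int -> L),
    mul (lconst b) (lseries k a) = lseries k (fun i => b * a i);
  dmul_Tpow : forall i j : int, mul (Tpow L i) (Tpow L j) = Tpow L (i + j);
  dmul_deg : forall f g, degl (mul f g) = (degl f + degl g)%E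
}.

(* a (a - 1) ... (a - k + 1) / k!, as an element of L (of characteristic 0) *)
Definition binomz (L : fieldType) (a : int) (k : nat) : L :=
  (\prod_(m < k) (a - m%:Z))%:~R / (k`!)%:R.

(* The pairs (l, (j_1, ..., j_k)) of nonpositive integers such that
   j_1 + ... + j_k - k + l = i; there are finitely many for each k, and none
   when k > - i. *)
Definition leibniz_index (i : int) (k : nat) : set (int * k.-tuple int) :=
  [set p : int * k.-tuple int |
     [/\ p.1 <= 0, (forall j : int, j \in p.2 -> j <= 0) &
         \sum_(j <- p.2) j - k%:Z + p.1 = i]].

Definition constants (L : fieldType) (delta : int -> L -> L) : set L :=
  \bigcap_(i in [set i : int | i <= 0]) [set a | delta i a = 0].

Definition linear_over (L : fieldType) (K : set L) (D : L -> L) : Prop :=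
  {morph D : x y / x + y} /\ forall c x, K c -> D (c * x) = c * D x.

Definition derivation_over (L : fieldType) (K : set L) (D : L -> L) : Prop :=
  linear_over K D /\ forall a b, D (a * b) = a * D b + D a * b.

(* Grothendieck's definition: D has order < n.+1 when every commutator
   [D, a] with the multiplication by a has order < n; only 0 has order < 0. *)
Fixpoint diffop_lt (L : fieldType) (K : set L) (n : nat) (D : L -> L) : Prop :=
  if n is n'.+1 then
    linear_over K D /\
    forall a, diffop_lt K n' (fun x => D (a * x) - a * D x)
  else forall x, D x = 0.

Definition diffop_over (L : fieldType) (K : set L) (D : L -> L) : Prop :=
  exists n, diffop_lt K n D.

(* Main.v *)
Require Import Defs.
From HB Require Import structures.
From mathcomp Require Import all_boot all_order all_algebra.
From mathcomp Require Import all_classical all_reals all_analysis.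
From mathcomp Require Import zify ring.

Set Implicit Arguments.
Unset Strict Implicit.
Unset Printing Implicit Defensive.

Import Order.TTheory GRing.Theory Num.Theory.

Local Open Scope classical_set_scope.
Local Open Scope ring_scope.

(* T (a b) = (T a) b, and (T a) b = a T b + \sum_l delta_l(a) T^l b.  For every
   integer l, the coefficient of T^(l - s) in T^l b is
     \sum_k binom(l, k) \sum_(j_1 + ... + j_k - k = - s)
       delta_(j_1) ... delta_(j_k)(b):
   by Pascal's rule these series are mapped to one another by T, the one with
   l = 0 is b, and T is invertible.  Comparing coefficients gives the Leibniz
   formula.  In its last sum only l > i occur, so it vanishes for i = i_0, and
   only j's > i occur, so the commutator of delta_i with the multiplication by
   a is an L-combination of 1 and of composites of maps delta_j with j > i,
   which are differential operators by induction; their orders do not depend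
   on a. *)

(** * Degrees and coefficients of Laurent series *)

Lemma morph_add0 (U V : zmodType) (g : U -> V) :
  {morph g : x y / x + y} -> g 0 = 0.
Proof. by move=> gD; apply: (addrI (g 0)); rewrite -gD !addr0. Qed.

(** This is deg f <= k without the value -oo; [degl_leP] gives the equivalence. *)
Definition vanishes_above (L : fieldType) (k : int) (f : laurent L) : Prop :=
  forall i, k < i -> f i = 0.

Lemma vanishes_aboveW (L : fieldType) (k m : int) (f : laurent L) :
  k <= m -> vanishes_above k f -> vanishes_above m f.
Proof. by move=> km fk i mi; apply: fk; exact: le_lt_trans mi. Qed.

Lemma vanishes_above_ex (L : fieldType) (f : laurent L) :
  exists k, vanishes_above k f.
Proof. exact/asboolP/(valP f). Qed.

Lemma coefl_lmonom (L : fieldType) (a : L) (i j : int) :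
  lmonom a i j = if j == i then a else 0.
Proof. by rewrite /=; case: eqP => [->|_]; rewrite ?lexx// if_same. Qed.

Lemma vanishes_above_lmonom (L : fieldType) (a : L) (k : int) :
  vanishes_above k (lmonom a k).
Proof. by move=> i ki; rewrite coefl_lmonom gt_eqF. Qed.

Lemma lseries_coefl (L : fieldType) (k : int) (f : laurent L) :
  vanishes_above k f -> lseries k f = f.
Proof. by move=> fk; apply: laurentP => i /=; case: leP => // /fk. Qed.

Lemma coefl_sum (L : fieldType) n (F : 'I_n -> laurent L) (i : int) :
  (\sum_(s < n) F s) i = \sum_(s < n) F s i.
Proof. exact: (big_morph (fun f : laurent L => f i) (id1 := 0)). Qed.

Lemma degl_leP (L : fieldType) (k : int) (f : laurent L) :
  (degl f <= k%:E)%E <-> vanishes_above k f.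
Proof.
have [->|/deglP[d [-> dn0 dmax]]] := eqVneq f 0; first by rewrite degl0 leNye.
rewrite lee_fin; split=> [dk|fk]; first exact: vanishes_aboveW dmax.
by rewrite leNgt; apply: contra dn0 => /fk ->.
Qed.

(* The degree bound makes F continuous, so that F is determined by the images
   of the monomials. *)
Lemma additive_coefl (L : fieldType) (F : laurent L -> laurent L) (d : int) :
  {morph F : f g / f + g} ->
  (forall f k, vanishes_above k f -> vanishes_above (k + d) (F f)) ->
  forall f k n i, vanishes_above k f -> k - n%:Z + d < i ->
    F f i = \sum_(s < n) F (lmonom (f (k - s%:Z)) (k - s%:Z)) i.
Proof.
move=> FD Fd f k n i fk ki.
pose g := \sum_(s < n) lmonom (f (k - s%:Z)) (k - s%:Z).
rewrite -coefl_sum -(big_morph F FD (morph_add0 FD)) -/g -[f in LHS](subrK g) FD coeflD.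
(* The tail f - g has degree at most k - n, so F sends it to degree at most k - n + d < i, where it
   is invisible. *)
suff fgk : vanishes_above (k - n%:Z) (f - g) by rewrite (Fd _ _ fgk)// add0r.
move=> j kj; rewrite coeflD coeflN coefl_sum.
have [jk|kltj] := leP j k; last first.
  rewrite fk// big1 ?subr0// => s _.
  by rewrite (@vanishes_above_lmonom _ _ (k - s%:Z))//; lia.
have sn : (`|k - j| < n)%N by lia.
have jE : j = k - `|k - j|%N%:Z by lia.
rewrite (bigD1 (Ordinal sn))//= -jE lexx eqxx big1 ?addr0 ?subrr// => s sP.
rewrite (_ : (j == _) = false) ?if_same//; apply: contraNF sP => /eqP js.
by apply/eqP/val_inj => /=; lia.
Qed.

(** * Multiplication by constants on the left and by powers of T on the right *)

Section DeformedMul.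
Variables (L : fieldType) (mul : laurent L -> laurent L -> laurent L).
Hypothesis mulP : deformed_mul mul.

Lemma dmul_vanishes f g k m : vanishes_above k f -> vanishes_above m g ->
  vanishes_above (k + m) (mul f g).
Proof.
move=> /degl_leP fk /degl_leP gm; apply/degl_leP.
by rewrite (dmul_deg mulP) EFinD leeD.
Qed.

Lemma dmul_lconst_coefl a f i : mul (lconst a) f i = a * f i.
Proof.
have [k fk] := vanishes_above_ex f.
rewrite -{1}(lseries_coefl fk) (dmul_scale mulP) /=.
by case: leP => // /fk ->; rewrite mulr0.
Qed.

Lemma dmul_lconst_lmonom a b i : mul (lconst a) (lmonom b i) = lmonom (a * b) i.
Proof.
apply: laurentP => j; rewrite dmul_lconst_coefl !coefl_lmonom.
by case: ifP; rewrite ?mulr0.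
Qed.

Lemma lmonomE a i : lmonom a i = mul (lconst a) (Tpow L i).
Proof. by rewrite dmul_lconst_lmonom mulr1. Qed.

(** Right multiplication by T^m is additive and shifts degrees by m, so [additive_coefl] reduces the
    claim to monomials, where a T^j T^m = a T^(j + m) by associativity. *)
Lemma dmul_Tpow_coefl f m i : mul f (Tpow L m) i = f (i - m).
Proof.
have [k0 fk0] := vanishes_above_ex f.
pose k : int := Num.max k0 (i - m).
have fk : vanishes_above k f by apply: vanishes_aboveW fk0; rewrite le_max lexx.
have ik : i - m <= k by rewrite le_max lexx orbT.
(* The wanted coefficient sits n steps below the top, so of the first n + 1 monomials of f only the
   last one contributes. *)
have [n iE] : exists n : nat, i = k - n%:Z + m.
  by exists (absz (k - (i - m))%R); lia.
have mulTD : {morph mul^~ (Tpow L m) : f g / f + g}.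
  by move=> *; rewrite (dmulDl mulP).
have mulTv h l : vanishes_above l h -> vanishes_above (l + m) (mul h (Tpow L m)).
  by move=> hl; apply: dmul_vanishes hl _; exact: vanishes_above_lmonom.
rewrite (additive_coefl mulTD mulTv (n := n.+1) fk) ?iE; last by lia.
have monE (s : nat) :
    mul (lmonom (f (k - s%:Z)) (k - s%:Z)) (Tpow L m) =
    lmonom (f (k - s%:Z)) (k - s%:Z + m).
  by rewrite lmonomE -(dmulA mulP) (dmul_Tpow mulP) -lmonomE.
rewrite big_ord_recr/= monE coefl_lmonom eqxx addrK big1 ?add0r// => s _.
rewrite monE coefl_lmonom; case: eqP => // /eqP.
by have := ltn_ord s; lia.
Qed.

End DeformedMul.

(** * Binomial coefficients with an integer upper argument *)

Lemma pchar0_natf_neq0 (F : fieldType) : [pchar F] =i pred0 ->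
  forall n, (0 < n)%N -> n%:R != 0 :> F.
Proof. by move=> /pcharf0P charF n n0; rewrite charF -lt0n. Qed.

Lemma binomz0 (L : fieldType) l : binomz L l 0 = 1.
Proof. by rewrite /binomz big_ord0 fact0 divr1. Qed.

Lemma binomz0S (L : fieldType) k : binomz L 0 k.+1 = 0.
Proof. by rewrite /binomz big_ord_recl subrr mul0r mul0r. Qed.

Lemma binomzS (L : fieldType) (charL : [pchar L] =i pred0) l k :
  binomz L (l + 1) k.+1 = binomz L l k.+1 + binomz L l k.
Proof.
rewrite /binomz big_ord_recl big_ord_recr /=.
(* The numerators share the product of the l - i for i < k; the extra factor is l + 1 on the left
   and l - k on the right. *)
have bumpE i : l + 1 - (bump 0 i)%:Z = l - i%:Z by rewrite /bump; lia.
under eq_bigr => i _ do rewrite bumpE.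
rewrite factS natrM !rmorphM !rmorphB rmorphD/=.
have := pchar0_natf_neq0 charL (fact_gt0 k).
have := pchar0_natf_neq0 charL (ltn0Sn k).
rewrite -natr1 -[k%:R]/(k%:~R : L); move: (_%:R) => v.
move: (\prod_(_ < k) _)%:~R => p u0 v0.
by field; rewrite u0 v0.
Qed.

(** Additivity gives integer scalars, and cancelling n gives fractions. It lets binomial
    coefficients pass through each [delta i]. *)
Lemma additive_fracZ (L : fieldType) (g : L -> L) (z : int) (n : nat) (x : L) :
  {morph g : x y / x + y} -> n%:R != 0 :> L ->
  g (z%:~R / n%:R * x) = z%:~R / n%:R * g x.
Proof.
move=> gD n0.
have gN y : g (- y) = - g y.
  by apply: (addIr (g y)); rewrite -gD !addNr morph_add0.
have gB : zmod_morphism g by move=> y w; rewrite gD gN.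
pose G : {additive L -> L} :=
  HB.pack g (GRing.isZmodMorphism.Build L L g gB).
have gn y : n%:R * G y = G (n%:R * y) by rewrite !mulr_natl raddfMn.
apply: (mulfI n0); rewrite -[g _]/(G _) gn !mulrA !(mulrC n%:R) !mulfK//.
by rewrite !mulrzl raddfMz.
Qed.

(** * Tuples of given weight and sums of composites over them *)

(* With s = \sum_(j <- u) (1 - j), the condition j_1 + ... + j_k - k + l = i
   reads s = l - i. *)
Fixpoint shifted_tuples (k s : nat) : seq (k.-tuple int) :=
  if k is k'.+1 then
    [seq cons_tuple (t.+1%:Z - s%:Z) u | t <- iota 0 s, u <- shifted_tuples k' t]
  else nseq (s == 0)%N [tuple].

(** The head j uses up 1 - j >= 1 of the weight s, which leaves t = s - (1 - j) < s for the tail;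
    hence j = t + 1 - s. *)
Lemma mem_shifted_tuples k s (u : k.-tuple int) :
  u \in shifted_tuples k s <->
  (forall j : int, j \in u -> j <= 0) /\ \sum_(j <- u) j - k%:Z = - s%:Z.
Proof.
elim: k s u => [|k IHk] s u.
  rewrite tuple0 /= mem_nseq eqxx andbT big_nil.
  by split=> [|[_]]; case: s => // s _; split=> // j.
split=> [/allpairsPdep[t [v [+ /IHk[v0 vE] ->]]]|].
  rewrite mem_iota /= => ts; split=> [j|].
    by rewrite inE => /orP[/eqP ->|/v0//]; lia.
  by rewrite big_cons; move: vE {ts}; move: (\sum_(i <- v) i) => S; lia.
case/tupleP: u => j v [jv0].
rewrite big_cons => jvE.
have j0 : j <= 0 by apply: jv0; rewrite mem_head.
have v0 i : i \in v -> i <= 0 by move=> iv; apply: jv0; rewrite inE iv orbT.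
have v_le : \sum_(i <- v) i <= 0.
  by rewrite big_seq_cond; apply: sumr_le0 => i /andP[/v0].
have [S SE] : exists S : int, \sum_(i <- v) i = S by exists (\sum_(i <- v) i).
rewrite SE in v_le jvE.
have sE : (absz (1 - j)%R <= s)%N by lia.
apply/allpairsPdep; exists (s - absz (1 - j)%R)%N, v; split.
- by rewrite mem_iota /=; lia.
- by apply/IHk; split=> //; rewrite SE; lia.
- by apply/val_inj => /=; congr (_ :: _); lia.
Qed.

(** Each entry has weight at least 1. This bounds k in the Leibniz sum. *)
Lemma shifted_tuples_gt k s : (s < k)%N -> shifted_tuples k s = [::].
Proof.
elim: k s => // k IHk s sk /=.
have : {in iota 0 s, forall t, shifted_tuples k t = [::]}.
  by move=> t; rewrite mem_iota => /andP[_ ts]; apply: IHk; lia.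
by elim: (iota 0 s) => //= t r IHr tr; rewrite tr ?mem_head// IHr// => i ir;
  apply: tr; rewrite inE ir orbT.
Qed.

Lemma shifted_tuples_uniq k s : uniq (shifted_tuples k s).
Proof.
elim: k s => [|k IHk] s /=; first by case: (s == 0)%N.
apply: allpairs_uniq_dep => [|t _|]; rewrite ?iota_uniq//.
move=> [t u] [t' u'] _ _ /= /(congr1 val) /= [tE uE].
have -> : t = t' by lia.
by congr existT; apply: val_inj.
Qed.

(** Let D be the formal sum of delta_j T^(j - 1) over j <= 0, with T a symbol commuting with the
    maps delta_j. This is the coefficient of T^(-s) in D^k, applied to b. *)
Definition shifted_sum (L : fieldType) (delta : int -> L -> L) (k s : nat)
    (b : L) :=
  \sum_(u <- shifted_tuples k s) foldr delta b u.

Lemma shifted_sum_gt (L : fieldType) (delta : int -> L -> L) k s b :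
  (s < k)%N -> shifted_sum delta k s b = 0.
Proof. by move=> sk; rewrite /shifted_sum shifted_tuples_gt// big_nil. Qed.

Lemma shifted_sum0 (L : fieldType) (delta : int -> L -> L) s b :
  shifted_sum delta 0 s b = if (s == 0)%N then b else 0.
Proof.
by rewrite /shifted_sum /=; case: (s == 0)%N; rewrite /= ?big_nil ?big_seq1.
Qed.

(** This is D^(k+1) = D D^k: the outermost map, of index t + 1 - s, is split off. *)
Lemma shifted_sumS (L : fieldType) (delta : int -> L -> L) k s b :
  (forall i : int, i <= 0 -> {morph delta i : x y / x + y}) ->
  shifted_sum delta k.+1 s b =
  \sum_(t < s) delta (t.+1%:Z - s%:Z) (shifted_sum delta k t b).
Proof.
move=> deltaD; rewrite /shifted_sum big_allpairs_dep.
have -> : iota 0 s = index_iota 0 s by rewrite /index_iota subn0.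
rewrite big_mkord; apply: eq_bigr => t _.
have i0 : t.+1%:Z - s%:Z <= 0 by have := ltn_ord t; lia.
by rewrite (big_morph _ (deltaD _ i0) (morph_add0 (deltaD _ i0))).
Qed.

(** * The product of a power of T with a constant *)

Section Deformation.
Variables (L : fieldType) (mul : laurent L -> laurent L -> laurent L).
Variable delta : int -> L -> L.
Hypothesis charL : [pchar L] =i pred0.
Hypothesis mulP : deformed_mul mul.
Hypothesis deltaE : forall a : L,
  mul (Tpow L 1) (lconst a) = lmonom a 1 + lseries 0 (fun i => delta i a).

Lemma T_lconst_coefl a i : mul (Tpow L 1) (lconst a) i =
  (if i == 1 then a else 0) + (if i <= 0 then delta i a else 0).
Proof. by rewrite deltaE coeflD coefl_lmonom. Qed.

Lemma delta_coefl a i : i <= 0 -> delta i a = mul (Tpow L 1) (lconst a) i.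
Proof.
by move=> i0; rewrite T_lconst_coefl i0 (_ : (i == 1) = false) ?add0r//; lia.
Qed.

Lemma deltaD i : i <= 0 -> {morph delta i : x y / x + y}.
Proof.
move=> i0 x y; rewrite !delta_coefl// -coeflD -(dmulDr mulP).
congr (mul _ _ _); apply: laurentP => j.
by rewrite coeflD !coefl_lmonom; case: ifP; rewrite ?addr0.
Qed.

Lemma T_lmonom_coefl c m i : mul (Tpow L 1) (lmonom c m) i =
  (if i - m == 1 then c else 0) + (if i - m <= 0 then delta (i - m) c else 0).
Proof.
by rewrite (lmonomE mulP) (dmulA mulP) (dmul_Tpow_coefl mulP) T_lconst_coefl.
Qed.

(** A monomial c T^(k - s) of f yields c at exponent k - s + 1 and delta_j(c) at exponent k - s + j.
    Exponent k + 1 - n is thus reached by the former for s = n, and by the latter with j = s + 1 - n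
    <= 0 for s < n. *)
Lemma T_coefl f k n : vanishes_above k f ->
  mul (Tpow L 1) f (k + 1 - n%:Z) =
  f (k - n%:Z) + \sum_(s < n) delta (s.+1%:Z - n%:Z) (f (k - s%:Z)).
Proof.
move=> fk.
have mulTv h l : vanishes_above l h -> vanishes_above (l + 1) (mul (Tpow L 1) h).
  move=> hl; rewrite addrC; apply: dmul_vanishes => //.
  exact: vanishes_above_lmonom.
rewrite (additive_coefl (dmulDr mulP _) mulTv (n := n.+1) fk); last by lia.
have subE (s : nat) : k + 1 - n%:Z - (k - s%:Z) = s.+1%:Z - n%:Z by lia.
rewrite big_ord_recr/= T_lmonom_coefl addrC subE.
rewrite (_ : n.+1%:Z - n%:Z = 1) /=; last by lia.
rewrite addr0; congr (_ + _); apply: eq_bigr => s _.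
rewrite T_lmonom_coefl subE; have := ltn_ord s => sn.
by rewrite ifF ?ifT ?add0r//; lia.
Qed.

(** The coefficient of T^(-n) in the binomial series (1 + D)^l, applied to b; D^k contributes only
    for k <= n. *)
Definition shifted_coef (l : int) (n : nat) (b : L) : L :=
  \sum_(k < n.+1) binomz L l k * shifted_sum delta k n b.

Lemma shifted_coef_widen l n N b : (n < N)%N ->
  shifted_coef l n b = \sum_(k < N) binomz L l k * shifted_sum delta k n b.
Proof.
move=> nN; rewrite /shifted_coef.
rewrite (big_ord_widen N (fun k => binomz L l k * shifted_sum delta k n b))//.
rewrite [RHS](bigID (fun k : 'I_N => (k < n.+1)%N)) /=.
rewrite [X in _ = _ + X]big1 ?addr0//.
by move=> k; rewrite -leqNgt => nk; rewrite shifted_sum_gt ?mulr0.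
Qed.

(** This is (1 + D)^(l+1) = (1 + D) (1 + D)^l, by Pascal's rule. *)
Lemma shifted_coefS l n b :
  shifted_coef (l + 1) n b =
  shifted_coef l n b +
  \sum_(s < n) delta (s.+1%:Z - n%:Z) (shifted_coef l s b).
Proof.
have -> : \sum_(s < n) delta (s.+1%:Z - n%:Z) (shifted_coef l s b) =
    \sum_(k < n) binomz L l k * shifted_sum delta k.+1 n b.
  under [RHS]eq_bigr => k _ do rewrite (shifted_sumS _ _ _ deltaD) big_distrr /=.
  rewrite exchange_big /=; apply: eq_bigr => s _.
  have i0 : s.+1%:Z - n%:Z <= 0 by have := ltn_ord s; lia.
  (* Since s < n, every inner sum extends by zeros to the common range k < n, independent of s. *)
  rewrite (shifted_coef_widen _ _ (ltn_ord s)).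
  rewrite (big_morph _ (deltaD i0) (morph_add0 (deltaD i0))); apply: eq_bigr => k _.
  apply: (additive_fracZ _ _ (deltaD i0)).
  exact/(pchar0_natf_neq0 charL)/fact_gt0.
rewrite /shifted_coef !big_ord_recl !binomz0 -addrA -big_split /=.
congr (_ + _); apply: eq_bigr => k _.
by rewrite (binomzS charL) mulrDl.
Qed.

Definition shifted_series (l : int) (b : L) : laurent L :=
  lseries l (fun i => shifted_coef l (absz (l - i)%R) b).

Lemma shifted_series_coefl l n b :
  shifted_series l b (l - n%:Z) = shifted_coef l n b.
Proof. by rewrite /= ifT; [congr shifted_coef|]; lia. Qed.

Lemma vanishes_above_lseries k (a : int -> L) : vanishes_above k (lseries k a).
Proof. by move=> i /=; case: leP. Qed.

Lemma T_shifted_series l b :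
  mul (Tpow L 1) (shifted_series l b) = shifted_series (l + 1) b.
Proof.
have lv : vanishes_above l (shifted_series l b) by exact: vanishes_above_lseries.
apply: laurentP => i; have [il|li] := leP i (l + 1); last first.
  rewrite (vanishes_above_lseries _ li).
  apply: (dmul_vanishes mulP (@vanishes_above_lmonom _ _ 1) lv).
  by rewrite addrC.
have -> : i = l + 1 - (absz (l + 1 - i)%R)%:Z by lia.
move: (absz _) => n; rewrite (T_coefl _ lv) !shifted_series_coefl shifted_coefS.
by congr (_ + _); apply: eq_bigr => s _; rewrite shifted_series_coefl.
Qed.

Lemma shifted_series0 b : shifted_series 0 b = lconst b.
Proof.
apply: laurentP => i; rewrite coefl_lmonom /=.
have [i0|i0] := leP i 0; last by rewrite gt_eqF.
rewrite /shifted_coef big_ord_recl binomz0 mul1r big1 ?addr0; last first.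
  by move=> k _; rewrite binomz0S mul0r.
by rewrite shifted_sum0 sub0r abszN absz_eq0.
Qed.

Lemma Tpow0 f : mul (Tpow L 0) f = f.
Proof. by apply: laurentP => i; rewrite (dmul_lconst_coefl mulP) mul1r. Qed.

Lemma Tpow_lconst l b : mul (Tpow L l) (lconst b) = shifted_series l b.
Proof.
have up (n : nat) l0 :
    mul (Tpow L n) (shifted_series l0 b) = shifted_series (l0 + n%:Z) b.
  elim: n => [|n IHn]; first by rewrite Tpow0 addr0.
  rewrite intS -(dmul_Tpow mulP) -(dmulA mulP) IHn T_shifted_series.
  by rewrite addrAC -addrA.
case: l => n; first by rewrite -shifted_series0 up add0r.
(* For a negative exponent l = -(n + 1), b itself is T^(n + 1) times the series at l, and
   multiplying by T^l isolates that series. *)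
rewrite NegzE -shifted_series0 -(addNr n.+1%:Z) -up (dmulA mulP) (dmul_Tpow mulP).
by rewrite addNr Tpow0.
Qed.

End Deformation.

(** * The Leibniz formula and its consequences for the constants and for delta_(i_0) *)

Section Leibniz.
Variables (L : fieldType) (mul : laurent L -> laurent L -> laurent L).
Variable delta : int -> L -> L.
Hypothesis charL : [pchar L] =i pred0.
Hypothesis mulP : deformed_mul mul.
Hypothesis deltaE : forall a : L,
  mul (Tpow L 1) (lconst a) = lmonom a 1 + lseries 0 (fun i => delta i a).

(** Compare the coefficients of T^(-n) in T (a b) = (T a) b. The monomial delta_(-r)(a) T^(-r) of T
    a, times b, reaches T^(-n) at distance n - r below its top exponent. *)
Lemma delta_mul_shifted_coef n a b :
  delta (- n%:Z) (a * b) = a * delta (- n%:Z) b +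
    \sum_(r < n.+1) delta (- r%:Z) a * shifted_coef delta (- r%:Z) (n - r) b.
Proof.
have n0 : - n%:Z <= 0 by lia.
rewrite (delta_coefl deltaE _ n0).
have <- : mul (lconst a) (lconst b) = lconst (a * b) by exact: dmul_lconst_lmonom.
rewrite (dmulA mulP) deltaE (dmulDl mulP) coeflD (lmonomE mulP) -(dmulA mulP).
rewrite (dmul_lconst_coefl mulP) -(delta_coefl deltaE _ n0); congr (_ + _).
have mulD : {morph mul^~ (lconst b) : f g / f + g}.
  by move=> *; rewrite (dmulDl mulP).
have mulv h k : vanishes_above k h -> vanishes_above (k + 0) (mul h (lconst b)).
  by move=> hk; apply: dmul_vanishes hk _ => //; exact: vanishes_above_lmonom.
have sv : vanishes_above 0 (lseries 0 (fun i => delta i a)).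
  exact: vanishes_above_lseries.
rewrite (additive_coefl mulD mulv (n := n.+1) sv); last by lia.
apply: eq_bigr => r _; have rn := ltn_ord r.
rewrite sub0r (lmonomE mulP) -(dmulA mulP) (dmul_lconst_coefl mulP).
rewrite (Tpow_lconst charL mulP deltaE).
rewrite (_ : - n%:Z = - r%:Z - (n - r)%N%:Z); last by lia.
by rewrite shifted_series_coefl /= oppr_le0.
Qed.

Lemma delta_mul n a b :
  delta (- n%:Z) (a * b) = a * delta (- n%:Z) b + delta (- n%:Z) a * b +
    \sum_(k < n) \sum_(r < n.+1)
      binomz L (- r%:Z) k.+1 * delta (- r%:Z) a * shifted_sum delta k.+1 (n - r) b.
Proof.
rewrite delta_mul_shifted_coef -addrA; congr (_ + _).
under eq_bigr => r _ do
  rewrite (shifted_coef_widen _ _ _ (leq_subr r n : (n - r < n.+1)%N))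
          big_distrr /=.
(* The term k = 0 survives only for r = n, where it is delta_(-n)(a) b. *)
rewrite exchange_big /= big_ord_recl; congr (_ + _).
  rewrite big_ord_recr /= subnn shifted_sum0 eqxx binomz0 mul1r.
  rewrite big1 ?add0r// => r _.
  by rewrite shifted_sum0 subn_eq0 leqNgt ltn_ord !mulr0.
by apply: eq_bigr => k _; apply: eq_bigr => r _; rewrite mulrCA mulrA.
Qed.

(** Enumerates [leibniz_index] at i = - n: with l = - r the tuple has weight l - i = n - r, and r <=
    n makes the natural subtraction exact. *)
Definition leibniz_seq (n k : nat) : seq (int * k.-tuple int) :=
  [seq (- r%:Z, u) | r <- iota 0 n.+1, u <- shifted_tuples k (n - r)].

Lemma leibniz_index_seq n k : @leibniz_index (- n%:Z) k = [set` leibniz_seq n k].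
Proof.
apply/seteqP; split=> [[l u] /= [l0 u0 uE]|p /= /allpairsPdep[r [u [+ + ->]]]].
  have u_le : \sum_(i <- u) i <= 0.
    by rewrite big_seq_cond; apply: sumr_le0 => i /andP[/u0].
  have [S SE] : exists S : int, \sum_(i <- u) i = S by exists (\sum_(i <- u) i).
  rewrite SE in u_le uE; rewrite /= in l0 uE.
  apply/allpairsPdep; exists (absz l), u; split; last by congr pair; lia.
    by rewrite mem_iota; lia.
  by apply/mem_shifted_tuples; split=> //; rewrite SE; lia.
rewrite mem_iota => /= rn /mem_shifted_tuples[u0 uE].
by split=> //=; rewrite ?uE; lia.
Qed.

Lemma leibniz_index_sum n k a b :
  \sum_(p \in @leibniz_index (- n%:Z) k)
    binomz L p.1 k * delta p.1 a * foldr delta b p.2 =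
  \sum_(r < n.+1)
    binomz L (- r%:Z) k * delta (- r%:Z) a * shifted_sum delta k (n - r) b.
Proof.
rewrite leibniz_index_seq -fsbig_seq /=; last first.
  apply: allpairs_uniq_dep => [|r _|]; rewrite ?iota_uniq ?shifted_tuples_uniq//.
  by move=> [r u] [r' u'] _ _ /= [/oppr_inj[->] ->].
rewrite big_allpairs_dep -[iota _ _]/(index_iota 0 n.+1) big_mkord.
by apply: eq_bigr => r _; rewrite /= /shifted_sum big_distrr.
Qed.

Lemma delta_leibniz (i : int) (a b : L) : i <= 0 ->
  delta i (a * b) = a * delta i b + delta i a * b +
    \sum_(k \in [set k : nat | (0 < k)%N])
      \sum_(p \in @leibniz_index i k)
        binomz L p.1 k * delta p.1 a * foldr delta b p.2.
Proof.
move=> i0; have -> : i = - (absz i)%:Z by lia.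
move: (absz i) => n {i i0}; rewrite delta_mul; congr (_ + _).
under [RHS]eq_fsbigr => k _ do rewrite leibniz_index_sum.
(* Only k = 1, ..., n contribute: for k > n no tuple of length k has weight n - r. *)
rewrite -(@fsbig_widen _ _ _ _ [set` [seq k.+1 | k <- iota 0 n]]) /=; last 2 first.
- by move=> k /= /mapP[m _ ->].
- move=> k [/= k0 kn]; rewrite big1// => r _; rewrite shifted_sum_gt ?mulr0//.
  have {}kn : (n < k)%N.
    rewrite ltnNge; apply/negP => kn'; apply: kn; apply/mapP; exists k.-1.
      by rewrite mem_iota; lia.
    by lia.
  by lia.
rewrite -fsbig_seq ?(map_inj_uniq succn_inj) ?iota_uniq// big_map.
have -> : iota 0 n = index_iota 0 n by rewrite /index_iota subn0.
by rewrite big_mkord.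
Qed.

Lemma delta0 i : i <= 0 -> delta i 0 = 0.
Proof.
move=> i0; apply: (addrI (delta i 0)).
by rewrite -(deltaD mulP deltaE)// !addr0.
Qed.

(** The innermost map kills b and the others preserve 0. *)
Lemma foldr_delta_eq0 (b : L) (s : seq int) : (0 < size s)%N ->
  (forall j : int, j \in s -> j <= 0) ->
  (forall j : int, j <= 0 -> delta j b = 0) ->
  foldr delta b s = 0.
Proof.
move=> + + b0; elim: s => // j [|j' s] IHs _ s0 /=.
  by rewrite b0// s0 ?mem_head.
rewrite -[delta j' _]/(foldr delta b (j' :: s)) IHs ?delta0// ?s0 ?mem_head//.
by move=> m ms; apply: s0; rewrite inE ms orbT.
Qed.

(** With the constant as second factor, every term of the Leibniz formula other than delta_i(a) c
    applies some delta_j to c. *)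
Lemma delta_mul_constr i a c : constants delta c -> i <= 0 ->
  delta i (a * c) = delta i a * c.
Proof.
move=> cK i0; rewrite delta_leibniz// cK// mulr0 add0r fsbig1 ?addr0//.
move=> k k0; rewrite fsbig1// => -[l u] /= [_ u0 _].
by rewrite foldr_delta_eq0 ?mulr0// size_tuple.
Qed.

Lemma linear_over_delta i : i <= 0 -> linear_over (constants delta) (delta i).
Proof.
move=> i0; split=> [|c x cK]; first exact: (deltaD mulP deltaE).
by rewrite mulrC delta_mul_constr// mulrC.
Qed.

Lemma constants1 : constants delta 1.
Proof.
move=> i /= i0; rewrite (delta_coefl deltaE _ i0) -[lconst 1]/(Tpow L 0).
by rewrite (dmul_Tpow mulP) coefl_lmonom lt_eqF//; lia.
Qed.

Lemma divring_closed_constants : divring_closed [in constants delta].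
Proof.
have KV c : constants delta c -> constants delta c^-1.
  (* The inverse of 0 is 0 by convention; otherwise delta_i(c^-1) c = delta_i(1) = 0. *)
  have [->|c0 cK i /= i0] := eqVneq c 0; first by rewrite invr0.
  apply: (mulIf c0); rewrite -delta_mul_constr// mulVf// mul0r.
  exact: constants1.
split=> [|x y|x y]; rewrite ?inE//; first exact: constants1.
- move=> xK yK i /= i0; have [dD _] := linear_over_delta i0.
  by apply: (addIr (delta i y)); rewrite -dD subrK xK// yK// addr0.
- move=> xK yK i /= i0.
  by rewrite delta_mul_constr ?xK ?mul0r//; exact: KV.
Qed.

Lemma derivation_over_delta i : i <= 0 ->
  (forall j : int, j <= 0 -> delta j <> cst 0 -> j <= i) ->
  derivation_over (constants delta) (delta i).
Proof.
move=> i0 imax; split=> [|a b]; first exact: linear_over_delta.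
have delta_gt j x : j <= 0 -> i < j -> delta j x = 0.
  move=> j0 ij; apply: contrapT => dx.
  have := imax j j0 (fun E : delta j = cst 0 => dx (congr1 (@^~ x) E)).
  by rewrite leNgt ij.
rewrite delta_leibniz// fsbig1 ?addr0// => k /= k0.
rewrite fsbig1// => -[l u] /= [l0 u0 uE].
have u_le : \sum_(j <- u) j <= 0.
  by rewrite big_seq_cond; apply: sumr_le0 => j /andP[/u0].
have [S SE] : exists S : int, \sum_(j <- u) j = S by exists (\sum_(j <- u) j).
rewrite SE in u_le uE; rewrite /= in l0 uE.
(* Here l = i + k - (j_1 + ... + j_k) > i because k > 0, so delta_l(a) = 0. *)
by rewrite delta_gt ?mulr0 ?mul0r//; lia.
Qed.

End Leibniz.

(** * Sums, multiples and composites of differential operators *)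

Section DifferentialOperators.
Variables (L : fieldType) (K : set L).
Implicit Types (D P Q : L -> L) (n m : nat) (a c : L).

Lemma diffop_lt_linear n D : diffop_lt K n D -> linear_over K D.
Proof.
case: n => [D0|n [//]]; split=> [x y|c x _]; first by rewrite !D0 addr0.
by rewrite !D0 mulr0.
Qed.

Lemma diffop_ltS n D : diffop_lt K n D -> diffop_lt K n.+1 D.
Proof.
elim: n D => [|n IHn] D Dn; split; try exact: diffop_lt_linear Dn.
  by move=> a x; rewrite !Dn mulr0 subr0.
by move=> a; apply: IHn; exact: Dn.2.
Qed.

Lemma diffop_ltW m n D : (m <= n)%N -> diffop_lt K m D -> diffop_lt K n D.
Proof.
move=> /subnK <-; elim: (n - m)%N => // d IHd Dm.
by rewrite addSn; apply: diffop_ltS; exact: IHd.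
Qed.

Lemma diffop_lt0 n : diffop_lt K n (fun=> 0).
Proof. exact: diffop_ltW (leq0n n) _. Qed.

Lemma diffop_lt_id : diffop_lt K 1 id.
Proof. by split=> [//|a x]; rewrite subrr. Qed.

Lemma diffop_ltD n P Q : diffop_lt K n P -> diffop_lt K n Q ->
  diffop_lt K n (fun x => P x + Q x).
Proof.
elim: n P Q => [|n IHn] P Q Pn Qn; first by move=> x; rewrite Pn Qn addr0.
case: Pn Qn => [[PD PZ] Pn] [[QD QZ] Qn]; split.
  by split=> [x y|c x Kc]; rewrite ?PD ?QD ?PZ ?QZ// ?mulrDr// addrACA.
move=> a; have := IHn _ _ (Pn a) (Qn a); congr (diffop_lt _ _ _).
by apply/funext => x; rewrite mulrDr opprD addrACA.
Qed.

Lemma diffop_ltZ n c P : diffop_lt K n P -> diffop_lt K n (fun x => c * P x).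
Proof.
elim: n P => [|n IHn] P Pn; first by move=> x; rewrite Pn mulr0.
case: Pn => [[PD PZ] Pn]; split.
  by split=> [x y|b x Kb]; rewrite ?PD ?mulrDr ?PZ// mulrCA.
move=> a; have := IHn _ (Pn a); congr (diffop_lt _ _ _).
by apply/funext => x; rewrite mulrBr (mulrCA a).
Qed.

Lemma diffop_lt_sum n (I : eqType) (r : seq I) (F : I -> L -> L) :
  (forall i, i \in r -> diffop_lt K n (F i)) ->
  diffop_lt K n (fun x => \sum_(i <- r) F i x).
Proof.
elim: r => [|i r IHr] Fn.
  have := diffop_lt0 n; congr (diffop_lt _ _ _).
  by apply/funext => x; rewrite big_nil.
have Fr : forall j, j \in r -> diffop_lt K n (F j).
  by move=> j jr; apply: Fn; rewrite inE jr orbT.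
have := diffop_ltD (Fn i (mem_head _ _)) (IHr Fr); congr (diffop_lt _ _ _).
by apply/funext => x; rewrite big_cons.
Qed.

(* [P Q, a] = P [Q, a] + [P, a] Q *)
Lemma diffop_lt_comp m n P Q : diffop_lt K m P -> diffop_lt K n Q ->
  diffop_lt K (m + n) (P \o Q).
Proof.
(* Induction on a bound of m + n, since one commutator term lowers n and the other lowers m. *)
move: {2}(m + n)%N (leqnn (m + n)) => N.
elim: N m n P Q => [|N IHN] m n P Q mnN Pm Qn.
  have /eqP m0 : (m == 0)%N by lia.
  have /eqP n0 : (n == 0)%N by lia.
  by subst m n => x /=; rewrite Pm.
have [PD PZ] := diffop_lt_linear Pm; have [QD QZ] := diffop_lt_linear Qn.
case: m => [|m] in mnN Pm *.
  have := diffop_lt0 (0 + n); congr (diffop_lt _ _ _).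
  by apply/funext => x /=; rewrite Pm.
case: n => [|n] in mnN Qn *.
  have := diffop_lt0 (m.+1 + 0); congr (diffop_lt _ _ _).
  by apply/funext => x /=; rewrite Qn (morph_add0 PD).
rewrite addSn; split.
  by split=> [x y|c x Kc] /=; rewrite ?QD ?PD ?QZ ?PZ.
move=> a.
have PQa : diffop_lt K (m + n.+1) (P \o (fun x => Q (a * x) - a * Q x)).
  by rewrite -addSnnS; apply: IHN Pm (Qn.2 a); lia.
have PaQ : diffop_lt K (m + n.+1) ((fun x => P (a * x) - a * P x) \o Q).
  by apply: IHN (Pm.2 a) Qn; lia.
have := diffop_ltD PQa PaQ.
congr (diffop_lt _ _ _); apply/funext => x /=.
have PB y z : P (y - z) = P y - P z.
  by apply: (addIr (P z)); rewrite -PD !subrK.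
by rewrite PB addrA subrK.
Qed.

(** The successor accounts for the empty composite, the identity, which has order < 1. *)
Lemma diffop_lt_foldr (delta : int -> L -> L) N (s : seq int) :
  (forall j, j \in s -> diffop_lt K N (delta j)) ->
  diffop_lt K (size s * N).+1 (fun b => foldr delta b s).
Proof.
elim: s => [|j s IHs] sN; first exact: diffop_lt_id.
rewrite [size _]/= mulSn -addnS; apply: (@diffop_lt_comp _ _ (delta j)).
  by apply: sN; rewrite mem_head.
by apply: IHs => i si; apply: sN; rewrite inE si orbT.
Qed.

End DifferentialOperators.

(** * The maps delta_i are differential operators *)

(** An entry j has weight 1 - j <= s. So the correction terms of the Leibniz formula for delta_(-n)
    compose only maps delta_(-m) with m < n, as the induction requires. *)
Lemma shifted_tuples_lt k s (u : k.-tuple int) j :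
  u \in shifted_tuples k s -> j \in u ->
  exists2 m, (m < s)%N & j = - m%:Z.
Proof.
elim: k s u => [|k IHk] s u; first by rewrite tuple0.
case/allpairsPdep => t [v [+ vt ->]]; rewrite mem_iota /= => ts.
rewrite inE => /orP[/eqP ->|/(IHk _ _ vt)[m mt ->]].
  by exists (s - t.+1)%N; lia.
by exists m => //; exact: ltn_trans mt _.
Qed.

Lemma diffop_lt_shifted_sum (L : fieldType) (K : set L) (delta : int -> L -> L)
    k s N :
  (forall m, (m < s)%N -> diffop_lt K N (delta (- m%:Z))) ->
  diffop_lt K (k * N).+1 (shifted_sum delta k s).
Proof.
move=> deltaN; apply: diffop_lt_sum => u us.
rewrite -[X in (X * N)%N](size_tuple u); apply: diffop_lt_foldr => j ju.
by have [m ms ->] := shifted_tuples_lt us ju; exact: deltaN.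
Qed.

Section Main.
Variables (L : fieldType) (mul : laurent L -> laurent L -> laurent L).
Variable delta : int -> L -> L.
Hypothesis charL : [pchar L] =i pred0.
Hypothesis mulP : deformed_mul mul.
Hypothesis deltaE : forall a : L,
  mul (Tpow L 1) (lconst a) = lmonom a 1 + lseries 0 (fun i => delta i a).

(** One bound N for all m < n carries the strong induction. *)
Lemma diffop_lt_delta n :
  exists N, forall m, (m < n)%N ->
    diffop_lt (constants delta) N (delta (- m%:Z)).
Proof.
elim: n => [|n [N deltaN]]; first by exists 0.
(* The commutator involves composites of at most n maps of order < N, so M bounds it for every a. *)
pose M := (n * N).+1.
have deltan : diffop_lt (constants delta) M.+1 (delta (- n%:Z)).
  split; first by apply: (linear_over_delta charL mulP deltaE); lia.
  move=> a.
  pose F (k : 'I_n) (r : 'I_n.+1) b :=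
    binomz L (- r%:Z) k.+1 * delta (- r%:Z) a * shifted_sum delta k.+1 (n - r) b.
  have -> : (fun x => delta (- n%:Z) (a * x) - a * delta (- n%:Z) x) =
      (fun x => delta (- n%:Z) a * x + \sum_k \sum_r F k r x).
    apply/funext => x; rewrite (delta_mul charL mulP deltaE).
    by rewrite -(addrA (a * _)) [a * _ + _]addrC addrK.
  apply: diffop_ltD.
    exact/diffop_ltZ/(diffop_ltW _ (diffop_lt_id _)).
  apply: diffop_lt_sum => k _; apply: diffop_lt_sum => r _.
  apply: diffop_ltZ; apply: (@diffop_ltW _ _ (k.+1 * N).+1).
    by rewrite ltnS leq_mul2r ltn_ord orbT.
  by apply: diffop_lt_shifted_sum => m mr; apply: deltaN; lia.
exists (maxn N M.+1) => m; rewrite ltnS leq_eqVlt => /orP[/eqP ->|mn].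
  exact: diffop_ltW (leq_maxr _ _) deltan.
exact: diffop_ltW (leq_maxl _ _) (deltaN m mn).
Qed.

Lemma diffop_over_delta i : i <= 0 -> diffop_over (constants delta) (delta i).
Proof.
move=> i0; have [N deltaN] := diffop_lt_delta (absz i).+1; exists N.
by have -> : i = - (absz i)%:Z by [lia]; exact: deltaN.
Qed.

End Main.

Theorem lemma3p6 (L : fieldType) (mul : laurent L -> laurent L -> laurent L)
    (delta : int -> L -> L)
    (charL : [pchar L] =i pred0)
    (mulP : deformed_mul mul)
    (deltaE : forall a : L,
      mul (Tpow L 1) (lconst a) = lmonom a 1 + lseries 0 (fun i => delta i a))
    (delta_neq0 : exists2 i : int, i <= 0 & delta i <> cst 0) :
  [/\ (forall (i : int) (a b : L), i <= 0 ->
        delta i (a * b) = a * delta i b + delta i a * b +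
          \sum_(k \in [set k : nat | (0 < k)%N])
            \sum_(p \in @leibniz_index i k)
              binomz L p.1 k * delta p.1 a * foldr delta b p.2),
      divring_closed [in constants delta],
      (exists i0 : int,
        [/\ i0 <= 0, delta i0 <> cst 0,
            (forall i : int, i <= 0 -> delta i <> cst 0 -> i <= i0) &
            derivation_over (constants delta) (delta i0)]) &
      (forall i : int, i <= 0 ->
        diffop_over (constants delta) (delta i))].
Proof.
split.
- by move=> i a b; exact: (delta_leibniz charL mulP deltaE).
- exact: (divring_closed_constants charL mulP deltaE).
(* The maximum i_0 is - n for the least n with delta_(-n) nonzero. *)
- have ex_n : exists n : nat, `[< delta (- n%:Z) <> cst 0 >].
    have [i i0 di] := delta_neq0; exists (absz i); apply/asboolP.
    by rewrite (_ : - (absz i)%:Z = i)//; lia.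
  case: (ex_minnP ex_n) => n /asboolP dn nmin.
  have n0 : - n%:Z <= 0 by lia.
  have imax (i : int) : i <= 0 -> delta i <> cst 0 -> i <= - n%:Z.
    move=> i0 di; have /nmin : `[< delta (- (absz i)%:Z) <> cst 0 >].
      by apply/asboolP; rewrite (_ : - (absz i)%:Z = i)//; lia.
    by lia.
  exists (- n%:Z); split=> //.
  exact: (derivation_over_delta charL mulP deltaE).
- exact: (diffop_over_delta charL mulP deltaE).
Qed.
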